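(* Let $N\ge0$, let $\bm Z_p\in C^1([0,T];\mathbb R^{2d})$ with values in $\Omega_z$, let $W^0,\bm W^1,\dots,\bm W^N$ be continuously differentiable functions of $t$ with values in symmetric tensors on $\mathbb R^{2d}$ ($\bm W^a$ of rank $a$), and let $$g_N=\sum_{a=0}^N\frac{(-1)^a}{a!}\sum_{i_1,\dots,i_a=1}^{2d}W^a_{i_1\dots i_a}(t)\,\partial_{z_{i_1}}\cdots\partial_{z_{i_a}}\delta(\bm z-\bm Z_p(t)).$$ Let $\bm A\in C^\infty(\Omega_z\times(0,T))^{2d}$ satisfy the coupling system $\bm{\mathcal A}[\bm A,g_N]=0$. Suppose that: (i) the phase space moments satisfy the moment hierarchy of degree $N$ closed with $g_N$: for every $k=0,\dots,N$, $$\partial_t\bm W^k=\int g_N\,\partial_t\big[(\bm z-\bm Z_p)^{\otimes k}\big]dz-\int\nabla_z\cdot(\bm A(\bm z,t)g_N)\,(\bm z-\bm Z_p)^{\otimes k}\,dz$$ (in particular $\partial_tW^0=0$); (ii) the center satisfies $\partial_t\bm Z_p=\bm A(\bm Z_p,t)$. Then $g_N$ is an exact (distributional) solution of the conservation law $\partial_t g+\nabla_z\cdot(\bm A g)=0$: for all $\phi\in C_0^\infty(\Omega_z\times(0,T))$, $$\int\partial_t g_N\,\phi\,dz\,dt+\int\nabla_z\cdot(\bm A\,g_N)\,\phi\,dz\,dt=0 .$$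
   Context: Setting: $d\ge1$, $\Omega_u,\Omega_x\subset\mathbb R^d$ are open, $T>0$, $\Omega_z=\Omega_u\times\Omega_x\subset\mathbb R^{2d}$ is phase space with coordinate $\bm z=(\bm u,\bm x)$. With smooth coefficients $\bm G,\bm F$ on $\Omega_u\times\Omega_x\times(0,T)$, the conservation law $\partial_t g+\nabla\cdot(\bm G g)+\nabla_u\cdot(\bm F g)=0$ (no source term) is written as $\partial_t g+\nabla_z\cdot(\bm A g)=0$ with $\bm A=(\bm F,\bm G)$. The coefficient $\bm A$ may depend on $g$; this dependence is encoded by an arbitrary system of differential-algebraic equations $\bm{\mathcal A}[\bm A,g]=0$, about which nothing is assumed except that it relates the smooth coefficient $\bm A$ to $g_N$. $\delta(\bm z-\bm Z_p(t))$ is the Dirac mass at $\bm Z_p(t)$; viewed as a distribution on $\Omega_z\times(0,T)$ it maps $\phi$ to $\int_0^T\phi(\bm Z_p(t),t)\,dt$. Derivatives of $g_N$ are distributional and obey the product rule and $\partial_t\delta(\bm z-\bm Z_p)=-\partial_t\bm Z_p\cdot\nabla_z\delta(\bm z-\bm Z_p)$. In (i), integrals over $\bm z$ denote, for fixed $t$, the pairing of a finite combination of $\bm z$-derivatives of the Dirac mass at $\bm Z_p(t)$ with a smooth function of $\bm z$; $\bm w^{\otimes k}$ is the $k$-fold outer product, $\bm w^{\otimes 0}=1$; identities are componentwise. *)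

(* Defs.v *)
From HB Require Import structures.
From mathcomp Require Import all_boot all_order all_algebra.
From mathcomp Require Import all_classical all_reals all_analysis.

Set Implicit Arguments.
Unset Strict Implicit.
Unset Printing Implicit Defensive.

Import Order.TTheory GRing.Theory Num.Theory.
Import numFieldNormedType.Exports.

Local Open Scope classical_set_scope.
Local Open Scope ring_scope.

(* [iter_derive [:: v1; ...; vk] f] is D_v1 (... (D_vk f)). *)
Definition iter_derive (R : realType) (E F : normedModType R)
    (vs : seq E) (f : E -> F) : E -> F :=
  foldr (fun v (g : E -> F) => 'D_v g) f vs.

(* C^oo on an open set U of a finite-dimensional space: directional derivatives
   of all orders exist and are differentiable, hence continuous, on U. *)
Definition smooth_on (R : realType) (E F : normedModType R)
    (U : set E) (f : E -> F) : Prop :=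
  forall (vs : seq E) (x : E), U x -> differentiable (iter_derive vs f) x.

(* A test function on U is represented by its extension by zero to E. *)
Definition test_function (R : realType) (E : normedModType R)
    (U : set E) (phi : E -> R) : Prop :=
  [/\ smooth_on [set: E] phi,
      compact (closure [set x | phi x != 0]) &
      closure [set x | phi x != 0] `<=` U].

(* C^1 on an interval I, with the derivative taken relative to I (so one-sided
   at the end points that belong to I); values of f outside I are irrelevant. *)
Definition C1_on (R : realType) (F : normedModType R)
    (I : set R) (f : R -> F) : Prop :=
  exists df : R -> F, {within I, continuous df} /\
    forall t, I t ->
      (s - t)^-1 *: (f s - f t) @[s --> within I t^'] --> df t.

(* Distributions are represented by total functionals on functions E -> R; only
   their values on functions that are smooth where it matters are meaningful. *)
Definition functional (R : realType) (E : normedModType R) : Type :=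
  (E -> R) -> R.

Definition fmul (R : realType) (E : normedModType R)
    (c : E -> R) (D : functional E) : functional E :=
  fun phi => D (fun x => c x * phi x).

Definition fderive (R : realType) (E : normedModType R)
    (v : E) (D : functional E) : functional E :=
  fun phi => - D ('D_v phi).

(* [fdiv e A D] is the divergence sum_i d_(e i) (A_i D). *)
Definition fdiv (R : realType) (E : normedModType R) (m : nat)
    (e : 'I_m -> E) (A : E -> 'rV[R]_m) (D : functional E) : functional E :=
  fun phi => \sum_(i < m) fderive (e i) (fmul (fun x => A x 0 i) D) phi.

Definition tensor (R : realType) (m a : nat) : Type := a.-tuple 'I_m -> R.

Definition symmetric_tensor (R : realType) (m a : nat)
    (X : tensor R m a) : Prop :=
  forall s s' : a.-tuple 'I_m, perm_eq s s' -> X s = X s'.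

Definition outer_power (R : realType) (m : nat) (w : 'rV[R]_m) (k : nat) :
    tensor R m k :=
  fun s => \prod_(i <- s) w 0 i.

(* sum_(a <= N) (-1)^a / a! sum_(i_1, ..., i_a)
     c^a_(i_1 ... i_a) d_(e i_1) ... d_(e i_a) D,
   with coefficients c that are functions on E. *)
Definition multipole (R : realType) (E : normedModType R) (m N : nat)
    (e : 'I_m -> E) (c : forall a : nat, E -> tensor R m a)
    (D : functional E) : functional E :=
  fun phi => \sum_(a < N.+1) (-1) ^+ a / a`!%:R *
    \sum_(s : a.-tuple 'I_m)
      fmul (fun x => c a x s)
        (foldr (fun i (D' : functional E) => fderive (e i) D') D s) phi.

Definition basis_z (R : realType) (m : nat) (i : 'I_m) : 'rV[R]_m :=
  delta_mx 0 i.

Definition dir_z (R : realType) (m : nat) (i : 'I_m) : 'rV[R]_m * R :=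
  (basis_z R i, 0).

Definition dir_t (R : realType) (m : nat) : 'rV[R]_m * R := (0, 1).

(* z = (u, x) is the row [row_mx u x]. *)
Definition phase_space (R : realType) (d : nat) (Ou Ox : set 'rV[R]_d) :
    set 'rV[R]_(d + d) :=
  [set z | Ou (lsubmx z) /\ Ox (rsubmx z)].

Definition dirac_at (R : realType) (E : normedModType R) (x : E) :
    functional E :=
  fun psi => psi x.

(* delta (z - Z t) as a distribution in (z, t), 0 < t < T. *)
Definition dirac_curve (R : realType) (m : nat) (T : R) (Z : R -> 'rV[R]_m) :
    functional ('rV[R]_m * R)%type :=
  fun phi => \int[lebesgue_measure]_(t in `]0, T[) phi (Z t, t).

(* g_N as a distribution in (z, t). *)
Definition g_approx (R : realType) (m N : nat) (T : R) (Z : R -> 'rV[R]_m)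
    (W : forall a : nat, R -> tensor R m a) :
    functional ('rV[R]_m * R)%type :=
  multipole N (@dir_z R m) (fun a p => W a p.2) (dirac_curve T Z).

(* g_N at a fixed time t, as a distribution in z. *)
Definition g_slice (R : realType) (m N : nat) (Z : R -> 'rV[R]_m)
    (W : forall a : nat, R -> tensor R m a) (t : R) : functional 'rV[R]_m :=
  multipole N (@basis_z R m) (fun a _ => W a t) (dirac_at (Z t)).

Definition moment_hierarchy (R : realType) (m N : nat) (T : R)
    (A : 'rV[R]_m * R -> 'rV[R]_m) (Z : R -> 'rV[R]_m)
    (W : forall a : nat, R -> tensor R m a) : Prop :=
  forall (k : nat) (t : R) (s : k.-tuple 'I_m), (k <= N)%N -> 0 < t < T ->
    derive1 (fun r => W k r s) t =
      g_slice N Z W t (fun z => derive1 (fun r => outer_power (z - Z r) s) t)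
      - fdiv (@basis_z R m) (fun z => A (z, t)) (g_slice N Z W t)
          (fun z => outer_power (z - Z t) s).

Definition distributional_solution (R : realType) (m : nat)
    (Q : set ('rV[R]_m * R)) (A : 'rV[R]_m * R -> 'rV[R]_m)
    (g : functional ('rV[R]_m * R)%type) : Prop :=
  forall phi : 'rV[R]_m * R -> R, test_function Q phi ->
    fderive (dir_t R m) g phi + fdiv (@dir_z R m) A g phi = 0.

(* Main.v *)
(** Fix t and let L be the pairing with g_N at time t, a multipole of order N at
    Z = Z_p(t). The relative speed B(z) = A(z, t) - A(Z, t) vanishes at Z, so
    f |-> L (B . grad f) only sees the derivatives of f up to order N at Z, and f
    may be replaced by its Taylor polynomial of degree N. On the monomials
    (z - Z)^{(x)k} the moment hierarchy says, thanks to Z' = A(Z, t), that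
    L (B . grad (z - Z)^{(x)k}) is exactly the derivative of W^k. Hence
    d/dt <g_N(t), phi(., t)> = <g_N(t), d_t phi + A . grad phi> for every test
    function phi, and integrating over (0, T) leaves no boundary terms. *)

Require Import Defs.
From HB Require Import structures.
From mathcomp Require Import all_boot all_order all_algebra.
From mathcomp Require Import all_classical all_reals all_analysis.

Set Implicit Arguments.
Unset Strict Implicit.
Unset Printing Implicit Defensive.

Import Order.TTheory GRing.Theory Num.Theory.
Import numFieldNormedType.Exports.

Local Open Scope classical_set_scope.
Local Open Scope ring_scope.

(** * Smooth functions on an open set *)

(** No estimate of a Taylor remainder occurs. A multipole sees finitely many derivatives at one
    point, so the Taylor polynomial enters only through its derivatives at the center, and vanishing
    to a given order is expressed by such derivatives. The price is the symmetry of mixed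
    derivatives ([deriveC]), used to differentiate Taylor polynomials and to move the derivative
    along the curve [(Z t, t)] past the spatial ones.

    Two domains of smoothness coexist. A test function, extended by zero, is smooth on the whole
    space, and derivatives are exchanged only there. The coefficient [A] is smooth on an open set
    only, so products with it are treated by statements relative to an open set, which never
    exchange derivatives.

    [W] and [A] are controlled on the open time interval only. All time integrals are therefore
    restricted to a segment [[al, be]] inside [(0, T)] at whose end points the test function
    vanishes. There each integrand is a pairing with a smooth function, hence derivable in time,
    hence continuous, as the fundamental theorem of calculus requires. *)

Lemma open_near_eq (T : topologicalType) (S : Type) (U : set T) (f g : T -> S) x :
  open U -> U x -> (forall y, U y -> f y = g y) -> \near x, f x = g x.
Proof.
by move=> oU Ux fg; have := open_nbhs_nbhs (conj oU Ux); apply: filterS.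
Qed.

(** The difference [g - f] vanishes near [x], so its differential there is the zero map by
    [diff_unique]; then [g = (g - f) + f]. *)
Lemma near_eq_differentiable (R : realType) (E F : normedModType R)
    (f g : E -> F) x :
  (\near x, f x = g x) -> differentiable f x -> differentiable g x.
Proof.
move=> fg df.
have k0 : (g - f) \o shift x =
    cst ((g - f) x) + (\0 : {linear E -> F}) +o_ (0 : E) id.
  have cx : h + x @[h --> (0 : E)] --> x.
    by rewrite -[X in _ --> X]add0r; apply: cvgD; [exact: cvg_id|exact: cvg_cst].
  apply/eqaddoP => /= e e0; near=> h.
  have fgh : f (h + x) = g (h + x) by near: h; exact: (cx _ fg).
  rewrite /= !fctE /= /shift /= fgh (nbhs_singleton fg) !subrr addr0 subr0.
  by rewrite normr0 mulr_ge0 // ltW.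
have c0 : continuous (\0 : {linear E -> F}) by move=> y; exact: cvg_cst.
have dk : differentiable (g - f) x.
  apply/diff_locallyP; have := diff_unique c0 k0 => ->.
  by split.
by rewrite -[g](subrK f); exact: differentiableD.
Unshelve. all: by end_near. Qed.

(** Avoids explicit formulas for iterated derivatives: a class of differentiable functions that is
    stable under one derivation contains only smooth functions. Stability up to equality on [U] is
    enough, because derivatives are local and [U] is open. *)
Lemma smooth_on_coind (R : realType) (E F : normedModType R) (U : set E)
    (P : (E -> F) -> Prop) :
  open U ->
  (forall f, P f -> forall x, U x -> differentiable f x) ->
  (forall f v, P f -> exists2 g, P g & forall x, U x -> 'D_v f x = g x) ->
  forall f, P f -> smooth_on U f.
Proof.
move=> oU Pd PD f Pf vs x Ux.
have [g Pg fg] : exists2 g, P g & forall y, U y -> iter_derive vs f y = g y.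
  elim: vs => [|v vs [g Pg fg]] /=; first by exists f.
  have [g' Pg' gg'] := PD _ v Pg; exists g' => // y Uy.
  rewrite -gg' //; apply: near_eq_derive; exact: open_near_eq fg.
apply: near_eq_differentiable (Pd _ Pg _ Ux).
by apply: (open_near_eq oU Ux) => y Uy; rewrite fg.
Qed.

Section smooth.
Variables (R : realType) (E : normedModType R) (U : set E).
Hypothesis oU : open U.

Lemma smooth_on_differentiable (F : normedModType R) (f : E -> F) x :
  smooth_on U f -> U x -> differentiable f x.
Proof. by move=> sf Ux; exact: (sf [::]). Qed.

Lemma smooth_on_derivable (F : normedModType R) (f : E -> F) v x :
  smooth_on U f -> U x -> derivable f x v.
Proof.
by move=> sf Ux; apply: diff_derivable; exact: smooth_on_differentiable.
Qed.

Lemma smooth_on_derive (F : normedModType R) (f : E -> F) v :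
  smooth_on U f -> smooth_on U ('D_v f).
Proof.
move=> sf vs x Ux; have := sf (rcons vs v) x Ux.
by rewrite /iter_derive foldr_rcons.
Qed.

Lemma smooth_on_sub (F : normedModType R) (V : set E) (f : E -> F) :
  V `<=` U -> smooth_on U f -> smooth_on V f.
Proof. by move=> VU sf vs x Vx; apply: sf; exact: VU. Qed.

Lemma smooth_on_eq (F : normedModType R) (f g : E -> F) :
  (forall x, U x -> f x = g x) -> smooth_on U f -> smooth_on U g.
Proof.
move=> fg sf.
apply: (smooth_on_coind (P := fun h => exists2 k, smooth_on U k &
    forall x, U x -> k x = h x) oU).
- move=> h [k sk kh] x Ux; apply: near_eq_differentiable (open_near_eq oU Ux kh) _.
  exact: smooth_on_differentiable.
- move=> h v [k sk kh]; exists ('D_v k).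
    by exists ('D_v k) => //; exact: smooth_on_derive.
  by move=> x Ux; apply/esym/near_eq_derive; exact: open_near_eq kh.
- by exists f.
Qed.

(** Products of smooth functions alone are not stable under derivation, since the Leibniz rule
    creates sums. This closure is stable, so [smooth_on_coind] applies to it. *)
Inductive sum_of_products : (E -> R) -> Prop :=
| sop_smooth f : smooth_on U f -> sum_of_products f
| sop_add f g : sum_of_products f -> sum_of_products g ->
    sum_of_products (f + g)
| sop_mul f g : sum_of_products f -> sum_of_products g ->
    sum_of_products (f * g).

Lemma sum_of_products_smooth (f : E -> R) : sum_of_products f -> smooth_on U f.
Proof.
have dif g : sum_of_products g -> forall x, U x -> differentiable g x.
  elim=> [h sh x Ux|h k _ dh _ dk x Ux|h k _ dh _ dk x Ux].
  - exact: smooth_on_differentiable.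
  - by apply: differentiableD; [exact: dh|exact: dk].
  - by apply: differentiableM; [exact: dh|exact: dk].
apply: (smooth_on_coind oU dif) => g v; elim=> {g}.
- move=> g sg; exists ('D_v g) => //.
  by apply: sop_smooth; exact: smooth_on_derive.
- move=> g h sg [g' sg' gg'] sh [h' sh' hh'].
  exists (g' + h'); first exact: sop_add.
  by move=> x Ux; rewrite deriveD ?gg' ?hh' //; apply/diff_derivable/dif.
- move=> g h sg [g' sg' gg'] sh [h' sh' hh'].
  exists (g * h' + h * g'); first by apply: sop_add; exact: sop_mul.
  by move=> x Ux; rewrite deriveM ?gg' ?hh' //; apply/diff_derivable/dif.
Qed.

Lemma smooth_on_cst (F : normedModType R) (c : F) : smooth_on U (cst c).
Proof.
apply: (smooth_on_coind (P := fun f => exists c, f = cst c) oU).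
- by move=> f [c' ->] x _; exact: differentiable_cst.
- move=> f v [c' ->]; exists (cst 0); first by exists 0.
  by move=> x _; rewrite derive_cst.
- by exists c.
Qed.

Lemma smooth_onD (f g : E -> R) :
  smooth_on U f -> smooth_on U g -> smooth_on U (fun x => f x + g x).
Proof.
by move=> sf sg; apply: sum_of_products_smooth; apply: sop_add; exact: sop_smooth.
Qed.

Lemma smooth_onM (f g : E -> R) :
  smooth_on U f -> smooth_on U g -> smooth_on U (fun x => f x * g x).
Proof.
by move=> sf sg; apply: sum_of_products_smooth; apply: sop_mul; exact: sop_smooth.
Qed.

Lemma smooth_onMl (c : R) (f : E -> R) :
  smooth_on U f -> smooth_on U (fun x => c * f x).
Proof. by move=> sf; apply: smooth_onM => //; exact: smooth_on_cst. Qed.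

Lemma smooth_onB (f g : E -> R) :
  smooth_on U f -> smooth_on U g -> smooth_on U (fun x => f x - g x).
Proof.
move=> sf sg; have := smooth_onD sf (smooth_onMl (-1) sg).
by apply: smooth_on_eq => x _; rewrite mulN1r.
Qed.

Lemma smooth_on_sum (I : Type) (r : seq I) (f : I -> E -> R) :
  (forall i, smooth_on U (f i)) -> smooth_on U (fun x => \sum_(i <- r) f i x).
Proof.
move=> sf; elim: r => [|i r IH].
  by under eq_fun do rewrite big_nil; exact: smooth_on_cst.
by under eq_fun do rewrite big_cons; exact: smooth_onD.
Qed.

Lemma smooth_on_prod (I : Type) (r : seq I) (f : I -> E -> R) :
  (forall i, smooth_on U (f i)) -> smooth_on U (fun x => \prod_(i <- r) f i x).
Proof.
move=> sf; elim: r => [|i r IH].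
  by under eq_fun do rewrite big_nil; exact: smooth_on_cst.
by under eq_fun do rewrite big_cons; exact: smooth_onM.
Qed.

Lemma differentiable_entry (m : nat) (f : E -> 'rV[R]_m) i x :
  differentiable f x -> differentiable (fun y => f y 0 i) x.
Proof.
move=> df; apply: (@differentiable_comp _ _ _ _ f (fun M => M 0 i)) => //.
exact: differentiable_coord.
Qed.

Lemma smooth_on_entry (m : nat) (f : E -> 'rV[R]_m) i :
  smooth_on U f -> smooth_on U (fun x => f x 0 i).
Proof.
move=> sf; apply: (smooth_on_coind (P := fun h => exists2 k : E -> 'rV[R]_m,
    smooth_on U k & forall x, U x -> k x 0 i = h x) oU).
- move=> h [k sk kh] x Ux; apply: near_eq_differentiable (open_near_eq oU Ux kh) _.
  by apply: differentiable_entry; exact: smooth_on_differentiable.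
- move=> h v [k sk kh]; exists (fun x => 'D_v k x 0 i).
    by exists ('D_v k) => //; exact: smooth_on_derive.
  move=> x Ux.
  rewrite derive_mx ?mxE; last exact: smooth_on_derivable.
  by apply/esym/near_eq_derive; exact: open_near_eq kh.
- by exists f.
Qed.

End smooth.

(** * Symmetry of second derivatives *)

Lemma is_derive_line (R : realType) (E F : normedModType R) (g : E -> F)
    (x u : E) (r : R) :
  derivable g (x + r *: u) u ->
  is_derive r 1 (fun s => g (x + s *: u)) ('D_u g (x + r *: u)).
Proof.
have e : (fun h : R => h^-1 *: (((fun s => g (x + s *: u)) \o shift r) (h *: 1)
      - g (x + r *: u))) =
    (fun h : R => h^-1 *: ((g \o shift (x + r *: u)) (h *: u) - g (x + r *: u))).
  by apply: funext => h /=; rewrite [h *: 1]mulr1 scalerDl addrCA.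
move=> dg; split; first by move: dg; rewrite /derivable -e.
by rewrite /derive -e.
Qed.

Lemma ler_dist_half (R : realType) (a b c e : R) :
  `|a - c| < e / 2 -> `|b - c| < e / 2 -> `|b - a| <= e.
Proof.
move=> ac bc; rewrite (le_trans (ler_distD c _ _)) // (splitr e).
by apply: lerD; rewrite ltW // distrC.
Qed.

Section Schwarz.
Variables (R : realType) (E : normedModType R).

Lemma MVT_line (g : E -> R) (x u : E) (h : R) : 0 < h ->
  (forall y, differentiable g y) ->
  exists2 a, 0 < a < h & g (x + h *: u) - g x = 'D_u g (x + a *: u) * h.
Proof.
move=> h0 dg.
have dline (s : R) : is_derive s 1 (fun s => g (x + s *: u)) ('D_u g (x + s *: u)).
  by apply: is_derive_line; exact: diff_derivable.
have [|a a0h] := @MVT R (fun s => g (x + s *: u))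
  (fun s => 'D_u g (x + s *: u)) 0 h h0.
  by apply: derivable_within_continuous => s _; have [] := dline s.
by rewrite scale0r addr0 subr0 => e; exists a.
Qed.

(** Two uses of the mean value theorem, along [u] for the increment of [f] by [h *: v], then along
    [v] for ['D_u f]. The left-hand side is symmetric in [u] and [v], which is what [deriveC]
    exploits. *)
Lemma second_difference (f : E -> R) (x u v : E) (h : R) : 0 < h ->
  smooth_on setT f ->
  exists ab : R * R, [/\ 0 < ab.1 < h, 0 < ab.2 < h &
    f (x + h *: v + h *: u) - f (x + h *: u) - (f (x + h *: v) - f x)
    = 'D_v ('D_u f) (x + ab.1 *: u + ab.2 *: v) * h * h].
Proof.
move=> h0 sf.
pose g y := f (y + h *: v) - f y.
have df y : differentiable f y by exact: smooth_on_differentiable sf I.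
have dfv y : differentiable (fun y => f (y + h *: v)) y.
  by apply: (@differentiable_comp _ _ _ _ (fun y => y + h *: v) f).
have dg y : differentiable g y by exact: differentiableB.
have [a a0h ea] := MVT_line x u h0 dg.
have Dg : 'D_u g (x + a *: u)
    = 'D_u f (x + a *: u + h *: v) - 'D_u f (x + a *: u).
  rewrite [g](_ : _ = (fun y => f (y + h *: v)) - f) // deriveB;
    [|exact/diff_derivable/dfv|exact/diff_derivable/df].
  congr (_ - _); rewrite /derive (_ : (fun s : R => _) = (fun s : R =>
    s^-1 *: ((f \o shift (x + a *: u + h *: v)) (s *: u) -
      f (x + a *: u + h *: v)))) //.
  by apply: funext => s /=; rewrite -!addrA.
have dDf y : differentiable ('D_u f) y.
  exact: smooth_on_differentiable (smooth_on_derive u sf) I.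
have [b b0h eb] := MVT_line (x + a *: u) v h0 dDf.
exists (a, b); split=> //=.
by rewrite -eb -Dg -ea /g (addrAC x (h *: v)).
Qed.

(** Schwarz's theorem: both mixed derivatives represent the same second difference divided by
    [h * h], at two points that may differ but are both close to [x]; continuity of the mixed
    derivatives at [x] then equates their values there. *)
Lemma deriveC (f : E -> R) (u v x : E) : smooth_on setT f ->
  'D_u ('D_v f) x = 'D_v ('D_u f) x.
Proof.
move=> sf; apply/eqP; rewrite -subr_eq0 -normr_le0.
apply/ler_addgt0Pl => e e0; rewrite addr0.
have near2 (g : E -> R) : smooth_on setT g -> \forall y \near x, `|g x - g y| < e / 2.
  move=> sg; have /differentiable_continuous := smooth_on_differentiable sg (I : setT x).
  by move=> /cvgrPdist_lt; apply; rewrite divr_gt0.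
have /nbhs_ballP[r /= r0 br] : \forall y \near x,
    `|'D_v ('D_u f) x - 'D_v ('D_u f) y| < e / 2 /\
    `|'D_u ('D_v f) x - 'D_u ('D_v f) y| < e / 2.
  by apply: filterI; apply: near2; apply: smooth_on_derive;
    exact: smooth_on_derive.
(* With this [h] every [x + a *: u + b *: v] with [a, b < h] lies in the ball of radius [r]; the
   summand 1 keeps the denominator positive when [u] and [v] are zero. *)
pose h := r / (`|u| + `|v| + 1).
have D0 : 0 < `|u| + `|v| + 1 by rewrite ltr_wpDl // addr_ge0.
have h0 : 0 < h by rewrite divr_gt0.
have near_x a b : 0 < a < h -> 0 < b < h -> ball x r (x + a *: u + b *: v).
  move=> /andP[a0 ah] /andP[b0 bh]; rewrite -ball_normE /= -addrA opprD addNKr.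
  rewrite normrN (le_lt_trans (ler_normD _ _)) // !normrZ !gtr0_norm //.
  rewrite (@le_lt_trans _ _ (h * (`|u| + `|v|))) //.
    by rewrite mulrDr lerD // ler_wpM2r // ltW.
  by rewrite /h mulrAC ltr_pdivrMr // ltr_pM2l // ltrDl.
have [[a b] /= [a0h b0h eab]] := second_difference x u v h0 sf.
have [[b' a'] /= [b0h' a0h' eab']] := second_difference x v u h0 sf.
have {eab eab'} ab_eq : 'D_v ('D_u f) (x + a *: u + b *: v) =
    'D_u ('D_v f) (x + a' *: u + b' *: v).
  apply: (mulIf (lt0r_neq0 h0)); apply: (mulIf (lt0r_neq0 h0)).
  rewrite [x + b' *: v + _]addrAC [x + h *: u + _]addrAC in eab'.
  rewrite -[LHS]eab -[RHS]eab' !opprB.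
  by rewrite addrACA [RHS]addrACA; congr (_ + _); exact: addrC.
have [p1 _] := br _ (near_x _ _ a0h b0h).
have [_ p2] := br _ (near_x _ _ a0h' b0h').
rewrite ab_eq in p1.
exact: ler_dist_half p1 p2.
Qed.

End Schwarz.

(** * Iterated derivatives and Taylor polynomials *)

(** The head of the list is differentiated first, unlike in [iter_derive]. This is the order in
    which iterated [fderive] hands derivatives to the test function. *)
Definition pderiv (R : realType) (E : normedModType R) (m : nat)
    (e : 'I_m -> E) (s : seq 'I_m) (f : E -> R) : E -> R :=
  foldl (fun (g : E -> R) i => 'D_(e i) g) f s.

Section pderiv.
Variables (R : realType) (E : normedModType R) (m : nat) (e : 'I_m -> E).
Variables (U : set E).
Hypothesis oU : open U.

Lemma smooth_on_pderiv s (f : E -> R) :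
  smooth_on U f -> smooth_on U (pderiv e s f).
Proof. by elim: s f => //= i s IH f sf; apply: IH; exact: smooth_on_derive. Qed.

Lemma pderiv_eq s (f g : E -> R) :
  (forall x, U x -> f x = g x) ->
  forall x, U x -> pderiv e s f x = pderiv e s g x.
Proof.
elim: s f g => //= i s IH f g fg x Ux; apply: IH => // y Uy.
by apply: near_eq_derive; exact: open_near_eq fg.
Qed.

Lemma pderivD s (f g : E -> R) x : smooth_on U f -> smooth_on U g -> U x ->
  pderiv e s (fun y => f y + g y) x = pderiv e s f x + pderiv e s g x.
Proof.
elim: s f g => //= i s IH f g sf sg Ux.
rewrite -IH //; [|exact: smooth_on_derive..].
apply: pderiv_eq => // y Uy.
by apply: deriveD; exact: smooth_on_derivable Uy.
Qed.

Lemma pderivMl s (c : R) (f : E -> R) x : smooth_on U f -> U x ->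
  pderiv e s (fun y => c * f y) x = c * pderiv e s f x.
Proof.
elim: s f => //= i s IH f sf Ux.
rewrite -IH //; [|exact: smooth_on_derive].
apply: pderiv_eq => // y Uy.
by apply: deriveZ; exact: smooth_on_derivable Uy.
Qed.

Lemma pderiv0 s x : pderiv e s (cst 0) x = 0.
Proof.
elim: s => //= i s IH; rewrite (_ : 'D_(e i) _ = cst 0) //.
by apply: funext => y; rewrite derive_cst.
Qed.

Lemma pderiv_sum s (I : Type) (r : seq I) (f : I -> E -> R) x :
  (forall i, smooth_on U (f i)) -> U x ->
  pderiv e s (fun y => \sum_(i <- r) f i y) x = \sum_(i <- r) pderiv e s (f i) x.
Proof.
move=> sf Ux; elim: r => [|i r IH].
  by under eq_fun do rewrite big_nil; rewrite big_nil; exact: pderiv0.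
under eq_fun do rewrite big_cons.
by rewrite big_cons -IH pderivD //; exact: smooth_on_sum.
Qed.

(** Vanishing to order [n] at [z], in terms of partial derivatives of order below [n] rather than
    growth. *)
Definition flat (z : E) n (f : E -> R) :=
  forall s, (size s < n)%N -> pderiv e s f z = 0.

(** Orders of vanishing add up: by the Leibniz rule each derivative falls on one factor and lowers
    the order of that factor by one. *)
Lemma flatM z n p (f g : E -> R) : U z -> smooth_on U f -> smooth_on U g ->
  flat z n f -> flat z p g -> flat z (n + p) (fun x => f x * g x).
Proof.
move=> Uz sf sg ff fg s; elim: s n p f g sf sg ff fg => /= [|i s IH] n p f g sf sg ff fg np.
  case: n ff np => [|n] ff np; first by rewrite [g z](fg [::]) ?mulr0.
  by rewrite [f z](ff [::]) ?mul0r.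
have flat_derive k (h : E -> R) : flat z k h -> flat z k.-1 ('D_(e i) h).
  by move=> fh s' ks'; apply: (fh (i :: s')); case: k ks' {fh}.
have -> : pderiv e s ('D_(e i) (fun x => f x * g x)) z =
    pderiv e s (fun x => f x * 'D_(e i) g x + g x * 'D_(e i) f x) z.
  by apply: pderiv_eq => // y Uy; apply: deriveM; exact: smooth_on_derivable Uy.
have sDf : smooth_on U ('D_(e i) f) by exact: smooth_on_derive.
have sDg : smooth_on U ('D_(e i) g) by exact: smooth_on_derive.
rewrite pderivD //; [|exact: smooth_onM..].
rewrite (IH n p.-1) ?(IH p n.-1) ?addr0 //; try exact: flat_derive.
  by case: n np {ff} => [|n] np; rewrite ?addn0 ?addnS /=; [exact: ltnW|rewrite addnC].
by case: p np {fg} => [|p]; rewrite ?addn0 ?addnS //=; exact: ltnW.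
Qed.

End pderiv.

(** Iterates [deriveC], hence the smoothness on the whole space. It lets the derivative in time and
    along the velocity of the center cross the spatial ones. *)
Lemma pderiv_derive (R : realType) (E : normedModType R) (m : nat)
    (e : 'I_m -> E) s v (f : E -> R) :
  smooth_on setT f -> pderiv e s ('D_v f) = 'D_v (pderiv e s f).
Proof.
elim: s f => //= i s IH f sf.
have -> : 'D_(e i) ('D_v f) = 'D_v ('D_(e i) f).
  by apply: funext => x; exact: deriveC.
by apply: IH; exact: smooth_on_derive.
Qed.

Lemma big_tuple_cons (R : nmodType) (I : finType) (k : nat)
    (F : k.+1.-tuple I -> R) :
  \sum_s F s = \sum_i \sum_(s : k.-tuple I) F [tuple of i :: s].
Proof.
rewrite pair_big /= (reindex (fun p : I * k.-tuple I => [tuple of p.1 :: p.2])) //=.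
exists (fun s => (thead s, [tuple of behead s])) => [[i s] _|s _] /=.
  by rewrite theadE; congr (_, _); exact: val_inj.
by rewrite [RHS]tuple_eta.
Qed.

Section Taylor.
Variables (R : realType) (m : nat) (z0 : 'rV[R]_m).
Local Notation pd := (pderiv (@basis_z R m)).

Lemma smooth_on_subr (U : set 'rV[R]_m) : open U ->
  smooth_on U (fun z : 'rV[R]_m => z - z0).
Proof.
move=> oU; apply: (smooth_on_coind (P := fun f =>
  f = (fun z => z - z0) \/ exists c, f = cst c) oU); last by left.
  move=> f [->|[c ->]] x _; last exact: differentiable_cst.
  by apply: differentiableB => //; exact: differentiable_cst.
move=> f v [->|[c ->]]; last first.
  by exists (cst 0); [right; exists 0|move=> x _; rewrite derive_cst].
exists (cst v); first by right; exists v.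
move=> x _; rewrite deriveB; [|exact: derivable_id|exact: derivable_cst].
by rewrite derive_id derive_cst subr0.
Qed.

Lemma smooth_on_outer_power k (s : k.-tuple 'I_m) (U : set 'rV[R]_m) : open U ->
  smooth_on U (fun z => outer_power (z - z0) s).
Proof.
move=> oU; apply: smooth_on_prod => // i.
by apply: (@smooth_on_entry _ _ _ oU _ (fun z => z - z0)); exact: smooth_on_subr.
Qed.

(** This is k! times the homogeneous part of degree [k] of the Taylor expansion at [z0]. Summing
    over tuples instead of multi-indices counts each monomial with its multinomial coefficient and
    matches the indexing of the tensors. *)
Definition hpoly k (f : 'rV[R]_m -> R) (z : 'rV[R]_m) : R :=
  \sum_(s : k.-tuple 'I_m) pd s f z0 * outer_power (z - z0) s.

Lemma smooth_on_hpoly k f (U : set 'rV[R]_m) : open U -> smooth_on U (hpoly k f).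
Proof.
move=> oU; apply: smooth_on_sum => // s; apply: smooth_onMl => //.
exact: smooth_on_outer_power.
Qed.

Lemma hpolyS k f z :
  hpoly k.+1 f z = \sum_i (z - z0) 0 i * hpoly k ('D_(basis_z R i) f) z.
Proof.
rewrite /hpoly big_tuple_cons; apply: eq_bigr => i _.
rewrite mulr_sumr; apply: eq_bigr => s _.
by rewrite /outer_power /= big_cons mulrCA.
Qed.

Lemma hpoly0 f z : hpoly 0 f z = f z0.
Proof.
rewrite /hpoly (eq_bigr (fun=> f z0)) ?sumr_const ?card_tuple ?expn0 //.
by move=> s _; rewrite tuple0 /outer_power big_nil mulr1.
Qed.

Lemma derive_entry_sub i j z :
  is_derive z (basis_z R j) (fun z : 'rV[R]_m => (z - z0) 0 i) (i == j)%:R.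
Proof.
have dz : derivable (fun z : 'rV[R]_m => z - z0) z (basis_z R j).
  by apply: derivableB; [exact: derivable_id|exact: derivable_cst].
split; first by have := (derivable_mxP _ _ _).1 dz 0 i.
have := derive_mx dz => /matrixP /(_ 0 i); rewrite mxE => <-.
rewrite deriveB; [|exact: derivable_id|exact: derivable_cst].
by rewrite derive_id derive_cst subr0 mxE eqxx.
Qed.

(** By [hpolyS] and the product rule, the linear factor contributes one copy of the result and the
    induction hypothesis [k] further ones, once the derivatives in the directions [i] and [j] are
    exchanged. In degree 0 the factor [k%:R] makes the truncated [k.-1] harmless. *)
Lemma derive_hpoly k f j z : smooth_on setT f ->
  'D_(basis_z R j) (hpoly k f) z = k%:R * hpoly k.-1 ('D_(basis_z R j) f) z.
Proof.
elim: k f z => [|k IH] f z sf.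
  rewrite mul0r (_ : hpoly 0 f = cst (f z0)) ?derive_cst //.
  by apply: funext => y; rewrite hpoly0.
have sh i : smooth_on setT (hpoly k ('D_(basis_z R i) f)).
  exact: smooth_on_hpoly openT.
have -> : hpoly k.+1 f = \sum_i (fun z : 'rV[R]_m => (z - z0) 0 i) *
    hpoly k ('D_(basis_z R i) f).
  by apply: funext => y; rewrite hpolyS fct_sumE.
have de i := derive_entry_sub i j z.
have dh i : derivable (hpoly k ('D_(basis_z R i) f)) z (basis_z R j).
  exact: smooth_on_derivable (sh i) I.
rewrite derive_sum => [|i]; last by apply: derivableM => //; case: (de i).
rewrite /= (eq_bigr (fun i => (i == j)%:R * hpoly k ('D_(basis_z R i) f) z +
   (z - z0) 0 i * (k%:R * hpoly k.-1 ('D_(basis_z R i) ('D_(basis_z R j) f)) z))).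
  rewrite big_split /= (bigD1 j) //= eqxx mul1r big1 ?addr0; last first.
    by move=> i /negbTE ->; rewrite mul0r.
  rewrite -natr1 mulrDl mul1r addrC; congr (_ + _).
  case: k {IH sh dh} => [|k] /=.
    by rewrite mul0r big1 // => i _; rewrite mul0r mulr0.
  by rewrite hpolyS mulr_sumr; apply: eq_bigr => i _; rewrite mulrCA.
move=> i _.
have DC : 'D_(basis_z R j) ('D_(basis_z R i) f) = 'D_(basis_z R i) ('D_(basis_z R j) f).
  by apply: funext => y; exact: deriveC.
have Dh : 'D_(basis_z R j) (hpoly k ('D_(basis_z R i) f)) z =
    k%:R * hpoly k.-1 ('D_(basis_z R i) ('D_(basis_z R j) f)) z.
  apply: etrans (congr1 (fun h => k%:R * hpoly k.-1 h z) DC).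
  by apply: IH; exact: smooth_on_derive.
have prod_rule (a b c d c' d' : R) : c = c' -> d = d' ->
  a *: c + b *: d = d' * b + a * c' by move=> -> ->; rewrite addrC [d' * b]mulrC.
have [dxi Dxi] := de i.
exact: etrans (deriveM dxi (dh i)) (prod_rule _ _ _ _ _ _ Dh Dxi).
Qed.

(** Here [n] counts terms: the degree is below [n], and degree [N] corresponds to [taylor N.+1]. *)
Definition taylor n (f : 'rV[R]_m -> R) (z : 'rV[R]_m) : R :=
  \sum_(k < n) k`!%:R^-1 * hpoly k f z.

Lemma smooth_on_taylor n f (U : set 'rV[R]_m) : open U -> smooth_on U (taylor n f).
Proof.
move=> oU; apply: smooth_on_sum => // k; apply: smooth_onMl => //.
exact: smooth_on_hpoly.
Qed.

(** The constant term drops out, and the factor k+1 from [derive_hpoly] turns 1/(k+1)! into 1/k!. *)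
Lemma derive_taylor n f j z : smooth_on setT f ->
  'D_(basis_z R j) (taylor n.+1 f) z = taylor n ('D_(basis_z R j) f) z.
Proof.
move=> sf.
have -> : taylor n.+1 f = \sum_(k < n.+1) (k`!%:R^-1 \*: hpoly k f).
  by apply: funext => y; rewrite fct_sumE.
have dh k : derivable (hpoly k f) z (basis_z R j).
  exact: smooth_on_derivable (@smooth_on_hpoly k f _ openT) I.
rewrite derive_sum => [|i]; last exact: derivableZ.
rewrite big_ord_recl deriveZ // derive_hpoly // mul0r scaler0 add0r.
apply: eq_bigr => k _; rewrite deriveZ // derive_hpoly //= /bump /= add1n.
rewrite factS natrM invfM -[X in X = _]/(_ * _) mulrA; congr (_ * _).
by rewrite mulrAC mulVf ?mul1r // pnatr_eq0.
Qed.

Lemma taylor_center n f : taylor n.+1 f z0 = f z0.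
Proof.
rewrite /taylor big_ord_recl fact0 invr1 mul1r hpoly0 big1 ?addr0 // => k _.
rewrite hpolyS big1 ?mulr0 // => i _.
by rewrite subrr mxE mul0r.
Qed.

(** By [derive_taylor] each derivative passes to [f] at the cost of one term; the bound on [size s]
    leaves at least one term when [taylor_center] evaluates the result. *)
Lemma pderiv_taylor s n f : smooth_on setT f -> (size s < n)%N ->
  pd s (taylor n f) z0 = pd s f z0.
Proof.
elim: s n f => [|i s IH] [//|n] f sf sn; first exact: taylor_center.
apply: etrans (IH n ('D_(basis_z R i) f) (smooth_on_derive _ sf) sn).
apply: (@pderiv_eq _ _ _ _ _ openT s ('D_(basis_z R i) (taylor n.+1 f))) => //.
by move=> y _; exact: derive_taylor.
Qed.

End Taylor.

(** * Multipoles at a fixed time *)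

Section slice.
Variables (R : realType) (m : nat).

Lemma derive_slice (F : normedModType R) (f : 'rV[R]_m * R -> F) v z t :
  'D_v (fun y => f (y, t)) z = 'D_((v, 0) : 'rV[R]_m * R) f (z, t).
Proof.
rewrite /derive (_ : (fun h : R => h^-1 *: ((f \o shift (z, t)) (h *: (v, 0)) - _)) =
  (fun h : R => h^-1 *: (((fun y => f (y, t)) \o shift z) (h *: v) - f (z, t)))) //.
apply: funext => h /=; congr (h^-1 *: (f _ - f _)).
by apply: injective_projections => //=; rewrite scaler0 add0r.
Qed.

Lemma pderiv_slice s (f : 'rV[R]_m * R -> R) z t :
  pderiv (@basis_z R m) s (fun y => f (y, t)) z = pderiv (@dir_z R m) s f (z, t).
Proof.
elim: s f => //= i s IH f; apply: etrans (IH _).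
have -> // : 'D_(basis_z R i) (fun y => f (y, t)) = (fun y => 'D_(dir_z R i) f (y, t)).
by apply: funext => y; exact: derive_slice.
Qed.

Lemma smooth_on_slice (F : normedModType R) (O : set 'rV[R]_m) (I : set R)
    (f : 'rV[R]_m * R -> F) t :
  open O -> I t -> smooth_on (O `*` I) f -> smooth_on O (fun z => f (z, t)).
Proof.
move=> oO It sf; apply: (smooth_on_coind (P := fun h => exists2 k : 'rV[R]_m * R -> F,
  smooth_on (O `*` I) k & h = (fun z => k (z, t))) oO); last by exists f.
- move=> h [k sk ->] z Oz.
  apply: (@differentiable_comp _ _ _ _ (fun z => (z, t)) k); last exact: (sk [::]).
  exact: differentiable_pair.
- move=> h v [k sk ->]; exists (fun z => 'D_((v, 0) : 'rV[R]_m * R) k (z, t)).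
    by exists ('D_((v, 0) : 'rV[R]_m * R) k) => //; exact: smooth_on_derive.
  by move=> z _; exact: derive_slice.
Qed.

End slice.

Section point_multipole.
Variables (R : realType) (m N : nat).
Variables (w : forall a, tensor R m a) (z0 : 'rV[R]_m).
Variable O : set 'rV[R]_m.
Hypotheses (oO : open O) (Oz0 : O z0).
Local Notation pd := (pderiv (@basis_z R m)).
Local Notation D i f := (derive f ^~ (basis_z R i)).

(** The pairing after all derivatives have been moved from the Dirac mass onto [f]; the signs are
    gone, see [multipoleE]. *)
Definition point_multipole (f : 'rV[R]_m -> R) : R :=
  \sum_(a < N.+1) a`!%:R^-1 * \sum_(s : a.-tuple 'I_m) w s * pd s f z0.
Local Notation L := point_multipole.

Lemma point_multipole_eq f g : (forall z, O z -> f z = g z) -> L f = L g.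
Proof.
move=> fg; apply: eq_bigr => a _; congr (_ * _); apply: eq_bigr => s _.
by congr (_ * _); exact: pderiv_eq fg _ Oz0.
Qed.

Lemma point_multipoleD (f g : 'rV[R]_m -> R) : smooth_on O f -> smooth_on O g ->
  L (fun z => f z + g z) = L f + L g.
Proof.
move=> sf sg; rewrite /L -big_split; apply: eq_bigr => a _ /=.
rewrite -mulrDr -big_split; congr (_ * _); apply: eq_bigr => s _ /=.
by rewrite -mulrDr; congr (_ * _); exact: pderivD sf sg Oz0.
Qed.

Lemma point_multipoleMl (c : R) (f : 'rV[R]_m -> R) : smooth_on O f -> L (fun z => c * f z) = c * L f.
Proof.
move=> sf; rewrite /L mulr_sumr; apply: eq_bigr => a _.
rewrite [RHS]mulrCA [c * _]mulr_sumr; congr (_ * _); apply: eq_bigr => s _.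
by rewrite [RHS]mulrCA; congr (_ * _); exact: pderivMl sf Oz0.
Qed.

Lemma point_multipole_sum (I : Type) (r : seq I) (f : I -> 'rV[R]_m -> R) :
  (forall i, smooth_on O (f i)) ->
  L (fun z => \sum_(i <- r) f i z) = \sum_(i <- r) L (f i).
Proof.
move=> sf; elim: r => [|i r IH].
  rewrite big_nil /L big1 // => a _; rewrite big1 ?mulr0 // => s _.
  by under eq_fun do rewrite big_nil; rewrite [X in _ * X]pderiv0 mulr0.
under eq_fun do rewrite big_cons.
by rewrite big_cons -IH point_multipoleD //; exact: smooth_on_sum.
Qed.

Lemma point_multipole_flat (f : 'rV[R]_m -> R) : flat (@basis_z R m) z0 N.+1 f -> L f = 0.
Proof.
move=> ff; rewrite /L big1 // => a _; rewrite big1 ?mulr0 // => s _.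
by rewrite ff ?mulr0 // size_tuple ltn_ord.
Qed.

Variable a : 'rV[R]_m -> 'rV[R]_m.
Hypothesis sa : smooth_on O a.

Definition relative_advection (f : 'rV[R]_m -> R) (z : 'rV[R]_m) : R :=
  \sum_i (a z 0 i - a z0 0 i) * D i f z.
Local Notation G := relative_advection.

Lemma smooth_on_relative_speed i : smooth_on O (fun z => a z 0 i - a z0 0 i).
Proof.
by apply: smooth_onB => //; [exact: smooth_on_entry|exact: smooth_on_cst].
Qed.

Lemma smooth_on_relative_advection_term (f : 'rV[R]_m -> R) i : smooth_on O f ->
  smooth_on O (fun z => (a z 0 i - a z0 0 i) * D i f z).
Proof.
move=> sf; apply: smooth_onM => //; first exact: smooth_on_relative_speed.
exact: smooth_on_derive.
Qed.

Lemma smooth_on_relative_advection (f : 'rV[R]_m -> R) : smooth_on O f -> smooth_on O (G f).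
Proof.
by move=> sf; apply: smooth_on_sum => // i; exact: smooth_on_relative_advection_term.
Qed.

Lemma advectionD (f g : 'rV[R]_m -> R) : smooth_on O f -> smooth_on O g ->
  L (G (fun z => f z + g z)) = L (G f) + L (G g).
Proof.
move=> sf sg; rewrite -point_multipoleD; [|exact: smooth_on_relative_advection..].
apply: point_multipole_eq => z Oz; rewrite /G -big_split; apply: eq_bigr => i _ /=.
rewrite -mulrDr; congr (_ * _).
by apply: deriveD; exact: smooth_on_derivable Oz.
Qed.

Lemma advectionMl (c : R) (f : 'rV[R]_m -> R) : smooth_on O f -> L (G (fun z => c * f z)) = c * L (G f).
Proof.
move=> sf; rewrite -point_multipoleMl; last exact: smooth_on_relative_advection.
apply: point_multipole_eq => z Oz; rewrite /G mulr_sumr; apply: eq_bigr => i _ /=.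
rewrite [RHS]mulrCA; congr (_ * _).
by apply: deriveZ; exact: smooth_on_derivable Oz.
Qed.

Lemma advection_sum (I : Type) (r : seq I) (f : I -> 'rV[R]_m -> R) :
  (forall i, smooth_on O (f i)) ->
  L (G (fun z => \sum_(i <- r) f i z)) = \sum_(i <- r) L (G (f i)).
Proof.
move=> sf; elim: r => [|i r IH].
  rewrite big_nil; under eq_fun do rewrite big_nil.
  have := @advectionMl 0 (cst 0) (smooth_on_cst oO 0).
  by under eq_fun do rewrite mul0r; rewrite mul0r.
under eq_fun do rewrite big_cons.
by rewrite big_cons -IH advectionD //; exact: smooth_on_sum.
Qed.

(* The relative speed vanishes at z0, so one derivative of f may be traded for
   it: G f is flat to the same order as f. *)
Lemma advection_flat (f : 'rV[R]_m -> R) : smooth_on O f ->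
  flat (@basis_z R m) z0 N.+1 f -> L (G f) = 0.
Proof.
move=> sf ff; rewrite /G point_multipole_sum; last first.
  by move=> i; exact: smooth_on_relative_advection_term.
apply: big1 => i _; apply: point_multipole_flat.
apply: (@flatM _ _ _ _ _ oO z0 1 N) => //; first exact: smooth_on_relative_speed.
- exact: smooth_on_derive.
- by case=> //= _; rewrite /pderiv /= subrr.
- by move=> s sN; exact: (ff (i :: s)).
Qed.

(** The remainder [f - taylor z0 N.+1 f] is killed by [advection_flat], and linearity reduces the
    rest to monomials. The right-hand side again has the shape of a [point_multipole], with new
    tensors in place of [w]. Smoothness on the whole space is what [pderiv_taylor] asks for. *)
Lemma advection_taylor (f : 'rV[R]_m -> R) : smooth_on setT f ->
  L (G f) = \sum_(k < N.+1) k`!%:R^-1 *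
    \sum_(s : k.-tuple 'I_m) L (G (fun z => outer_power (z - z0) s)) * pd s f z0.
Proof.
move=> sf; have sfO : smooth_on O f by exact: smooth_on_sub sf.
have sT : smooth_on O (taylor z0 N.+1 f) by exact: smooth_on_taylor.
have sT' : smooth_on setT (taylor z0 N.+1 f) by exact: (@smooth_on_taylor _ _ _ _ _ _ openT).
have -> : L (G f) = L (G (fun z => taylor z0 N.+1 f z + (f z - taylor z0 N.+1 f z))).
  by congr (L (G _)); apply: funext => z; rewrite addrC subrK.
rewrite advectionD //; last exact: smooth_onB.
rewrite (@advection_flat (fun z => f z - taylor z0 N.+1 f z)); first last.
- move=> s sN.
  have -> : (fun z => f z - taylor z0 N.+1 f z) =
      (fun z => f z + -1 * taylor z0 N.+1 f z).
    by apply: funext => z; rewrite mulN1r.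
  rewrite (pderivD _ openT) //; last exact: (smooth_onMl openT).
  by rewrite (pderivMl _ openT) // pderiv_taylor // mulN1r subrr.
- exact: smooth_onB.
rewrite addr0 advection_sum; last first.
  by move=> k; apply: smooth_onMl => //; exact: smooth_on_hpoly.
apply: eq_bigr => k _; rewrite advectionMl; last exact: smooth_on_hpoly.
congr (_ * _); rewrite advection_sum; last first.
  by move=> s; apply: smooth_onMl => //; exact: smooth_on_outer_power.
apply: eq_bigr => s _; rewrite advectionMl; last exact: smooth_on_outer_power.
exact: mulrC.
Qed.

Lemma advection_split (f : 'rV[R]_m -> R) : smooth_on O f ->
  \sum_i L (fun z => a z 0 i * D i f z) =
  L (G f) + \sum_i a z0 0 i * L (D i f).
Proof.
move=> sf; have sDf i : smooth_on O (D i f) by exact: smooth_on_derive.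
rewrite /G point_multipole_sum; last first.
  by move=> i; exact: smooth_on_relative_advection_term.
rewrite -big_split; apply: eq_bigr => i _ /=.
rewrite -point_multipoleMl // -point_multipoleD; last exact: smooth_onMl.
  by apply: point_multipole_eq => z _; rewrite -mulrDl subrK.
exact: smooth_on_relative_advection_term.
Qed.

End point_multipole.

(** * Evolution of the pairing with a test function *)

Lemma is_derive_curve (R : realType) (V F : normedModType R) (g : R -> V)
    (f : V -> F) (t : R) :
  derivable g t 1 -> differentiable f (g t) ->
  is_derive t 1 (fun r => f (g r)) ('D_(derive1 g t) f (g t)).
Proof.
move=> /derivable1_diffP dg df.
have dfg : differentiable (f \o g) t by exact: differentiable_comp.
split; first exact: diff_derivable.
rewrite [LHS](@deriveE _ _ _ (f \o g) t 1 dfg).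
by rewrite diff_comp //= derive1E (deriveE _ dg) (deriveE _ df).
Qed.

Lemma is_derive_bigsum (R : realType) (I : Type) (r : seq I) (f : I -> R -> R)
    (df : I -> R) (t : R) : (forall i, is_derive t 1 (f i) (df i)) ->
  is_derive t 1 (fun x => \sum_(i <- r) f i x) (\sum_(i <- r) df i).
Proof.
move=> fdf; elim: r => [|i r IH].
  by under eq_fun do rewrite big_nil; rewrite big_nil; exact: (is_derive_cst 0 t 1).
by under eq_fun do rewrite big_cons; rewrite big_cons; exact: is_deriveD.
Qed.

Lemma derive_row (R : realType) (m : nat) (F : normedModType R)
    (f : 'rV[R]_m -> F) v z :
  differentiable f z -> 'D_v f z = \sum_j v 0 j *: 'D_(basis_z R j) f z.
Proof.
move=> df; rewrite deriveE // {1}[v]row_sum_delta linear_sum.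
by apply: eq_bigr => j _; rewrite linearZ /= -deriveE.
Qed.

Lemma derive_phase_time (R : realType) (m : nat) (f : 'rV[R]_m * R -> R) v r p :
  differentiable f p ->
  'D_((v, r) : 'rV[R]_m * R) f p =
  \sum_j v 0 j * 'D_(dir_z R j) f p + r * 'D_(dir_t R m) f p.
Proof.
case: p => z t df.
have -> : ((v, r) : 'rV[R]_m * R) = (v, 0) + r *: dir_t R m.
  apply: injective_projections => /=; first by rewrite scaler0 addr0.
  by rewrite add0r [r *: 1]mulr1.
rewrite deriveE // linearD linearZ /= -!deriveE //; congr (_ + _).
rewrite -derive_slice derive_row.
  by apply: eq_bigr => j _; congr (_ * _); exact: derive_slice.
exact: (@differentiable_comp _ _ _ _ (fun y => (y, t)) f).
Qed.

(** Moving the center along [Z] amounts to keeping it at [Z t] and moving the point along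
    [g r = z + Z t - Z r], which passes through [z] at time [t] with velocity opposite to that of
    [Z]. *)
Lemma derive1_outer_power (R : realType) (m k : nat) (Z : R -> 'rV[R]_m)
    (s : k.-tuple 'I_m) z (t : R) : derivable Z t 1 ->
  derive1 (fun r => outer_power (z - Z r) s) t =
  - \sum_j derive1 Z t 0 j * 'D_(basis_z R j) (fun y => outer_power (y - Z t) s) z.
Proof.
move=> dZ; pose g r := z + Z t - Z r.
have dc : derivable (cst (z + Z t)) t (1 : R) by exact: derivable_cst.
have dg : derivable g t 1 by exact: derivableB dc dZ.
have g1 : derive1 g t = - derive1 Z t.
  by rewrite !derive1E; apply: etrans (deriveB dc dZ) _; rewrite derive_cst sub0r.
have gt : g t = z by rewrite /g addrK.
have dP : differentiable (fun y => outer_power (y - Z t) s) z.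
  exact: smooth_on_differentiable (smooth_on_outer_power _ _ openT) I.
rewrite [X in derive1 X](_ : _ = (fun r => outer_power (g r - Z t) s)); last first.
  by apply: funext => r; rewrite /g (addrAC z) addrK.
have := @is_derive_curve _ _ _ g (fun y => outer_power (y - Z t) s) t dg.
rewrite gt g1 => /(_ dP)[_ Dg].
rewrite [LHS]derive1E; apply: etrans Dg _; rewrite derive_row // -sumrN; apply: eq_bigr => j _.
by rewrite mxE; exact: mulNr.
Qed.

Section multipole.
Variables (R : realType) (E : normedModType R) (m : nat) (e : 'I_m -> E).

Lemma foldr_fderive (D : functional E) s phi :
  foldr (fun i (D' : functional E) => fderive (e i) D') D s phi =
  (-1) ^+ size s * D (pderiv e s phi).
Proof.
elim: s phi => [|i s IH] phi; first by rewrite mul1r.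
by rewrite /= /fderive IH exprS mulN1r mulNr.
Qed.

(** The sign [(-1) ^+ a] in the definition cancels the one produced by [a] integrations by parts. *)
Lemma multipoleE N (c : forall a, E -> tensor R m a) (D : functional E) phi :
  multipole N e c D phi = \sum_(a < N.+1) a`!%:R^-1 *
    \sum_(s : a.-tuple 'I_m) D (pderiv e s (fun x => c a x s * phi x)).
Proof.
apply: eq_bigr => a _; rewrite mulrAC mulrC; congr (_ * _).
rewrite mulr_sumr; apply: eq_bigr => s _.
by rewrite /fmul foldr_fderive size_tuple mulrA -expr2 sqrr_sign mul1r.
Qed.

End multipole.

Section moments.
Variables (R : realType) (m N : nat) (T : R) (O : set 'rV[R]_m).
Variables (Z : R -> 'rV[R]_m) (W : forall a : nat, R -> tensor R m a).
Arguments W : clear implicits.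
Variable A : 'rV[R]_m * R -> 'rV[R]_m.
Hypotheses (oO : open O) (OZ : forall t : R, 0 < t < T -> O (Z t)).
Hypothesis dZ : forall t : R, 0 < t < T -> derivable Z t 1.
Hypothesis dW : forall a (s : a.-tuple 'I_m) (t : R), (a <= N)%N -> 0 < t < T ->
  derivable (fun r => W a r s) t 1.
Hypothesis sA : smooth_on (O `*` `]0, T[) A.
Hypothesis hm : moment_hierarchy N T A Z W.
Hypothesis hc : forall t : R, 0 < t < T -> derive1 Z t = A (Z t, t).

Lemma g_sliceE (t : R) (f : 'rV[R]_m -> R) : 0 < t < T -> smooth_on O f ->
  g_slice N Z W t f = point_multipole N (fun a => W a t) (Z t) f.
Proof.
move=> tT sf; rewrite /g_slice multipoleE; apply: eq_bigr => a _; congr (_ * _).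
by apply: eq_bigr => s _; exact: pderivMl oO _ _ _ _ sf (OZ tT).
Qed.

Lemma smooth_on_A (t : R) : 0 < t < T -> smooth_on O (fun z => A (z, t)).
Proof. by move=> tT; apply: smooth_on_slice sA => //=; rewrite in_itv. Qed.

Lemma moment_advection k (t : R) (s : k.-tuple 'I_m) : (k <= N)%N -> 0 < t < T ->
  derive1 (fun r => W k r s) t =
  point_multipole N (fun a => W a t) (Z t)
    (relative_advection (Z t) (fun z => A (z, t))
      (fun z => outer_power (z - Z t) s)).
Proof.
move=> kN tT; rewrite hm //; set P := fun z => outer_power (z - Z t) s.
have sP : smooth_on O P by exact: smooth_on_outer_power.
have sDP j : smooth_on O ('D_(basis_z R j) P) by exact: smooth_on_derive.
have sAt := smooth_on_A tT.
have -> : (fun z => derive1 (fun r => outer_power (z - Z r) s) t) =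
    (fun z => -1 * \sum_j A (Z t, t) 0 j * 'D_(basis_z R j) P z).
  apply: funext => z; rewrite derive1_outer_power; last exact: dZ.
  by rewrite hc // mulN1r.
have sADP j : smooth_on O (fun z => A (Z t, t) 0 j * 'D_(basis_z R j) P z).
  exact: smooth_onMl.
rewrite g_sliceE //; last by apply: smooth_onMl => //; exact: smooth_on_sum.
rewrite (point_multipoleMl _ _ oO (OZ tT)); last exact: smooth_on_sum.
rewrite (point_multipole_sum _ _ oO (OZ tT)) //.
rewrite (eq_bigr (fun j => A (Z t, t) 0 j * point_multipole N (fun a => W a t) (Z t)
  ('D_(basis_z R j) P))); last first.
  by move=> j _; exact: (point_multipoleMl _ _ oO (OZ tT)).
have := advection_split N (fun a => W a t) oO (OZ tT) sAt sP.
rewrite mulN1r => /eqP; rewrite -subr_eq => /eqP <-.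
rewrite addrC; congr (_ - _).
rewrite /fdiv -sumrN; apply: eq_bigr => i _; rewrite /fderive opprK /fmul.
by rewrite g_sliceE //; apply: smooth_onM => //; exact: smooth_on_entry.
Qed.

Definition pairing (t : R) (phi : 'rV[R]_m * R -> R) : R :=
  point_multipole N (fun a => W a t) (Z t) (fun z => phi (z, t)).

Lemma is_derive_pairing (t : R) (phi : 'rV[R]_m * R -> R) :
  smooth_on setT phi -> 0 < t < T ->
  is_derive t 1 (fun r => pairing r phi)
    (pairing t ('D_(dir_t R m) phi) +
     \sum_i pairing t (fun x => A x 0 i * 'D_(dir_z R i) phi x)).
Proof.
move=> sphi tT.
pose psi z := phi (z, t); have sAt := smooth_on_A tT.
have spsi : smooth_on setT psi.
  apply: (@smooth_on_slice _ _ _ _ setT phi t openT) => //.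
  exact: smooth_on_sub sphi.
have sDt : smooth_on O (fun z => 'D_(dir_t R m) phi (z, t)).
  apply: (@smooth_on_slice _ _ _ _ setT ('D_(dir_t R m) phi) t oO) => //.
  exact: (smooth_on_sub (@subsetT _ _) (smooth_on_derive _ sphi)).
have spsiO : smooth_on O psi by exact: smooth_on_sub spsi.
have sDpsi j : smooth_on O ('D_(basis_z R j) psi) by exact: smooth_on_derive.
have sADpsi j : smooth_on O (fun z => A (Z t, t) 0 j * 'D_(basis_z R j) psi z).
  exact: smooth_onMl.
have dZt : differentiable Z t by apply/derivable1_diffP; exact: dZ.
have did : differentiable (@idfun R) t by [].
have dpair := differentiable_pair dZt did.
have dcurve : derivable (fun r => (Z r, r)) t 1 by exact/derivable1_diffP.
have dcurve1 : derive1 (fun r => (Z r, r)) t = (A (Z t, t), 1).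
  rewrite derive1E; apply: etrans (deriveE (1 : R) dpair) _.
  by rewrite (diff_pair dZt did) diff_val -hc // derive1E deriveE.
have dterm a (s : a.-tuple 'I_m) : (a <= N)%N -> is_derive t 1
    (fun r => W a r s * pderiv (@basis_z R m) s (fun z => phi (z, r)) (Z r))
    (W a t s * pderiv (@basis_z R m) s (fun z => 'D_(dir_t R m) phi (z, t)) (Z t) +
     (derive1 (fun r => W a r s) t * pderiv (@basis_z R m) s psi (Z t) +
      W a t s * pderiv (@basis_z R m) s
        (fun z => \sum_j A (Z t, t) 0 j * 'D_(basis_z R j) psi z) (Z t))).
  move=> aN; have sPhi : smooth_on setT (pderiv (@dir_z R m) s phi).
    exact: smooth_on_pderiv.
  have dPhi : is_derive t 1 (fun r => pderiv (@dir_z R m) s phi (Z r, r))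
      (pderiv (@basis_z R m) s
         (fun z => \sum_j A (Z t, t) 0 j * 'D_(basis_z R j) psi z) (Z t) +
       pderiv (@basis_z R m) s (fun z => 'D_(dir_t R m) phi (z, t)) (Z t)).
    apply: is_derive_eq (is_derive_curve dcurve _) _.
      exact: smooth_on_differentiable sPhi I.
    rewrite dcurve1 derive_phase_time; last exact: smooth_on_differentiable sPhi I.
    rewrite mul1r; congr (_ + _); last first.
      by rewrite (pderiv_slice s ('D_(dir_t R m) phi)) pderiv_derive.
    rewrite (pderiv_sum _ oO) //; last exact: OZ.
    apply: eq_bigr => j _.
    rewrite (pderivMl _ oO) //; last exact: OZ.
    congr (_ * _).
    have Dpd := pderiv_derive (@dir_z R m) s (dir_z R j) sphi.
    apply: etrans (esym (congr1 (fun h => h (Z t, t)) Dpd)) _ => /=.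
    rewrite -(pderiv_slice s ('D_(dir_z R j) phi)).
    have -> // : 'D_(basis_z R j) psi = (fun z => 'D_(dir_z R j) phi (z, t)).
    by apply: funext => z; exact: derive_slice.
  under eq_fun do rewrite pderiv_slice.
  have dWt : is_derive t 1 (fun r => W a r s) (derive1 (fun r => W a r s) t).
    by rewrite derive1E; apply: derivableP; exact: dW.
  apply: is_derive_eq (is_deriveM dWt dPhi) _.
  rewrite -(pderiv_slice s phi) -[X in X + _]/(_ * _) -[X in _ + X]/(_ * _).
  by rewrite mulrDr addrC addrA [LHS]addrC; congr (_ + (_ + _)); exact: mulrC.
(* It remains to rewrite the claimed derivative as a multipole sum with the same three contributions
   as in [dterm]. *)
have -> : pairing t ('D_(dir_t R m) phi) +
     \sum_i pairing t (fun x => A x 0 i * 'D_(dir_z R i) phi x) =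
   \sum_(a < N.+1) a`!%:R^-1 * \sum_(s : a.-tuple 'I_m)
    (W a t s * pderiv (@basis_z R m) s (fun z => 'D_(dir_t R m) phi (z, t)) (Z t) +
     (derive1 (fun r => W a r s) t * pderiv (@basis_z R m) s psi (Z t) +
      W a t s * pderiv (@basis_z R m) s
        (fun z => \sum_j A (Z t, t) 0 j * 'D_(basis_z R j) psi z) (Z t))).
  have -> : \sum_i pairing t (fun x => A x 0 i * 'D_(dir_z R i) phi x) =
      \sum_i point_multipole N (fun a => W a t) (Z t)
        (fun z => A (z, t) 0 i * 'D_(basis_z R i) psi z).
    apply: eq_bigr => i _; rewrite /pairing; congr (point_multipole _ _ _ _).
    by apply: funext => z; rewrite derive_slice.
  rewrite (advection_split N (fun a => W a t) oO (OZ tT) sAt spsiO).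
  (* After the expansion, the tensors in front of the derivatives of [psi] are the relative
     advections of the monomials, which [moment_advection] identifies with the time derivatives of
     [W] in every degree up to [N]. *)
  rewrite (advection_taylor N (fun a => W a t) oO (OZ tT) sAt spsi).
  have -> : \sum_j A (Z t, t) 0 j * point_multipole N (fun a => W a t) (Z t)
      ('D_(basis_z R j) psi) = point_multipole N (fun a => W a t) (Z t)
      (fun z => \sum_j A (Z t, t) 0 j * 'D_(basis_z R j) psi z).
    rewrite (point_multipole_sum _ _ oO (OZ tT)) //; apply: eq_bigr => j _.
    by rewrite (point_multipoleMl _ _ oO (OZ tT)).
  rewrite /pairing /point_multipole -!big_split; apply: eq_bigr => a _ /=.
  rewrite -!mulrDr -!big_split; congr (_ * _); apply: eq_bigr => s _ /=.
  congr (_ + (_ * _ + _)).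
  by rewrite moment_advection // -ltnS ltn_ord.
rewrite /pairing /point_multipole.
apply: is_derive_bigsum => a; apply: is_deriveZ; apply: is_derive_bigsum => s.
by apply: dterm; rewrite -ltnS ltn_ord.
Qed.

End moments.

(** * Integration in time *)

(** At an interior point the restriction to [I] in the limit is void, and [s = h + t] turns one
    difference quotient into the other. *)
Lemma C1_on_derivable (R : realType) (F : normedModType R) (I : set R)
    (f : R -> F) (t : R) : nbhs t I -> C1_on I f -> derivable f t 1.
Proof.
move=> tI [df [_ dfI]]; apply/cvg_ex; exists (df t).
have tt : h + t @[h --> 0^'] --> within I t^'.
  have ht : h + t @[h --> (0 : R)] --> t.
    by rewrite -[X in _ --> X]add0r; apply: cvgD; [exact: cvg_id|exact: cvg_cst].
  move=> B tB.
  have hB : \forall h \near (0 : R), I (h + t) /\ (h + t != t -> I (h + t) -> B (h + t)).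
    exact: ht _ (filterI tI tB).
  suff : \forall h \near (0 : R), h != 0 -> B (h + t) by [].
  by apply: filterS hB => h [It tBh] h0; apply: tBh; rewrite // -subr_eq0 addrK.
have := cvg_comp _ _ tt (dfI _ (nbhs_singleton tI)).
apply: cvg_trans; apply: near_eq_cvg; near=> h => /=.
by rewrite addrK [h *: 1]mulr1.
Unshelve. all: by end_near. Qed.

Section integral.
Variables (R : realType) (al be : R).
Local Notation mu := (@lebesgue_measure R).

Lemma integrable_derivable (f : R -> R) :
  {in `[al, be], forall t : R, derivable f t 1} ->
  mu.-integrable `[al, be] (EFin \o f).
Proof.
move=> df; apply: continuous_compact_integrable; first exact: segment_compact.
exact: derivable_within_continuous.
Qed.

Lemma derivable_bigsum (I : Type) (r : seq I) (f : I -> R -> R) (t : R) :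
  (forall i, derivable (f i) t 1) -> derivable (fun x => \sum_(i <- r) f i x) t 1.
Proof.
move=> df.
by have [] := @is_derive_bigsum _ _ r f _ t (fun i => derivableP (df i)).
Qed.

Lemma Rintegral_bigsum (I : Type) (r : seq I) (f : I -> R -> R) :
  (forall i, {in `[al, be], forall t : R, derivable (f i) t 1}) ->
  \int[mu]_(t in `[al, be]) (\sum_(i <- r) f i t) =
  \sum_(i <- r) \int[mu]_(t in `[al, be]) f i t.
Proof.
move=> df; elim: r => [|i r IH].
  rewrite big_nil; under eq_Rintegral do rewrite big_nil.
  by rewrite Rintegral_cst // mul0r.
under eq_Rintegral do rewrite big_cons.
rewrite big_cons -IH RintegralD //; apply: integrable_derivable => //.
by move=> t tab; apply: derivable_bigsum => j; exact: df.
Qed.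

Lemma Rintegral_support (T : R) (f : R -> R) : 0 < al -> be < T ->
  (forall t, 0 < t < T -> ~ al <= t <= be -> f t = 0) ->
  \int[mu]_(t in `]0, T[) f t = \int[mu]_(t in `[al, be]) f t.
Proof.
move=> al0 beT f0; rewrite Rintegral_mkcond [RHS]Rintegral_mkcond.
apply: eq_Rintegral => t _; rewrite !patchE !mem_setE !in_itv /=.
have [tab|tab] := boolP (al <= t <= be).
  by move: tab => /andP[alt tbe]; rewrite (lt_le_trans al0 alt) (le_lt_trans tbe beT).
by case: ifP => // tT; apply: f0 => //; exact/negP.
Qed.

(** Derivability of the integrand supplies the continuity required by the fundamental theorem of
    calculus; it is the form in which regularity of the pairings is available. *)
Lemma Rintegral_derive (f F : R -> R) : al < be ->
  {in `[al, be], forall t : R, derivable f t 1} ->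
  {in `[al, be], forall t : R, is_derive t 1 F (f t)} ->
  \int[mu]_(t in `[al, be]) f t = F be - F al.
Proof.
move=> ab df dF.
have cF (t : R) : t \in `[al, be] -> {for t, continuous F}.
  move=> /dF[dFt _]; apply: differentiable_continuous.
  exact/derivable1_diffP.
have sub (t : R) : t \in `]al, be[ -> t \in `[al, be].
  by rewrite !in_itv /= => /andP[? ?]; rewrite !ltW.
have F_LR : derivable_oo_LRcontinuous F al be.
  split.
  + by move=> t /sub /dF[].
  + by apply: cvg_at_right_filter; apply: cF; rewrite in_itv /= lexx ltW.
  + by apply: cvg_at_left_filter; apply: cF; rewrite in_itv /= lexx ltW.
have F1 : {in `]al, be[, derive1 F =1 f}.
  by move=> t /sub /dF[_ Ft]; rewrite derive1E.
by rewrite /Rintegral (continuous_FTC2 ab (derivable_within_continuous df) F_LR F1).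
Qed.

End integral.

Lemma open_setX (S T : topologicalType) (A : set S) (B : set T) :
  open A -> open B -> open (A `*` B).
Proof.
move=> oA oB; have -> : A `*` B = fst @^-1` A `&` snd @^-1` B by [].
by apply: openI; apply: open_comp => // p _; [exact: cvg_fst|exact: cvg_snd].
Qed.

(** * Support in time of a test function *)

Section time_support.
Variables (R : realType) (m : nat).

(** The segment is closed, so its complement is open and the property is inherited by derivatives in
    all directions. *)
Definition time_supported (al be : R) (f : 'rV[R]_m * R -> R) :=
  forall z t, ~ al <= t <= be -> f (z, t) = 0.

Lemma derive_time_supported al be f v :
  time_supported al be f -> time_supported al be ('D_v f).
Proof.
move=> f0 z t tab.
pose V := [set p : 'rV[R]_m * R | ~ al <= p.2 <= be].
have oV : open V.
  have -> : V = snd @^-1` ~` [set` `[al, be]].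
    by apply/seteqP; split => p /=; rewrite in_itv.
  apply: open_comp; first by move=> p _; exact: cvg_snd.
  by rewrite openC; exact: itv_closed.
have -> : 'D_v f (z, t) = 'D_v (cst 0) (z, t).
  by apply: near_eq_derive; apply: (open_near_eq oV) => // -[y s]; exact: f0.
exact: derive_cst.
Qed.

(** The time coordinate attains its extrema on the compact support, inside [(0, T)]. The strict
    inequalities in the conclusion make [phi] vanish at the times [al] and [be] too, which removes
    the boundary terms. *)
Lemma test_function_time_support (O : set 'rV[R]_m) (T : R) phi :
  0 < T -> test_function (O `*` `]0, T[) phi ->
  exists al be : R, [/\ 0 < al, al < be, be < T &
    forall z t, ~ al < t < be -> phi (z, t) = 0].
Proof.
move=> T0 [_]; set K := closure _ => cK KQ.
have phiK p : ~ K p -> phi p = 0.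
  move=> nKp; apply: contra_notP nKp => /eqP np.
  exact: subset_closure.
have [K0|/set0P/negP/negPn/eqP K0] := pselect (K !=set0); last first.
  (* If the support is empty, any segment inside [(0, T)] will do. *)
  exists (T / 3), (T / 3 * 2); split => [||| z t _].
  - by rewrite divr_gt0.
  - by rewrite ltr_pMr ?divr_gt0 // ltr1n.
  - by rewrite mulrAC ltr_pdivrMr // ltr_pM2l // ltr_nat.
  - by apply: phiK; rewrite K0.
have csnd : {within K, continuous (snd : 'rV[R]_m * R -> R)}.
  by apply: continuous_subspaceT => p; exact: cvg_snd.
have [c /set_mem Kc cmax] := compact_EVT_max K0 cK csnd.
have [b /set_mem Kb bmin] := compact_EVT_min K0 cK csnd.
have [_ /=] := KQ _ Kc; rewrite in_itv /= => /andP[c0 cT].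
have [_ /=] := KQ _ Kb; rewrite in_itv /= => /andP[b0 bT].
have bc : b.2 <= c.2 by apply: cmax; exact/mem_set.
have ab : b.2 / 2 < b.2 by rewrite ltr_pdivrMr // ltr_pMr // ltr1n.
(* Midpoints between 0 and the first time of the support, and between its last time and [T]: the
   margin on both sides gives [al < be] even if the support lies at a single time. *)
exists (b.2 / 2), ((c.2 + T) / 2); split.
- by rewrite divr_gt0.
- by rewrite (lt_trans (lt_le_trans ab bc)) // midf_lt.
- by rewrite midf_lt.
- move=> z t tab; apply: phiK => Kzt; apply: tab; apply/andP; split.
    by rewrite (lt_le_trans ab) //; apply: (bmin (z, t)); exact/mem_set.
  rewrite (@le_lt_trans _ _ c.2) ?midf_lt //.
  by apply: (cmax (z, t)); exact/mem_set.
Qed.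

End time_support.

(** * The space-time functional as a time integral of pairings *)

Section weak_form.
Variables (R : realType) (m N : nat) (T al be : R) (O : set 'rV[R]_m).
Variables (Z : R -> 'rV[R]_m) (W : forall a : nat, R -> tensor R m a).
Arguments W : clear implicits.
Hypotheses (oO : open O) (OZ : forall t : R, 0 < t < T -> O (Z t)).
Hypothesis dZ : forall t : R, 0 < t < T -> derivable Z t 1.
Hypothesis dW : forall a (s : a.-tuple 'I_m) (t : R), (a <= N)%N -> 0 < t < T ->
  derivable (fun r => W a r s) t 1.
Hypotheses (al0 : 0 < al) (beT : be < T).

Lemma segment_sub (t : R) : t \in `[al, be] -> 0 < t < T.
Proof.
rewrite in_itv /= => /andP[alt tbe].
by rewrite (lt_le_trans al0 alt) (le_lt_trans tbe beT).
Qed.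

(** Here [f] need only be smooth on the domain, so that products with [A] are covered. Derivability
    gives the integrability and continuity needed on [[al, be]]. *)
Lemma derivable_pairing_term a (s : a.-tuple 'I_m) (t : R) f : (a <= N)%N ->
  smooth_on (O `*` `]0, T[) f -> 0 < t < T ->
  derivable (fun r => W a r s * pderiv (@basis_z R m) s (fun z => f (z, r)) (Z r)) t 1.
Proof.
move=> aN sf tT; under eq_fun do rewrite (pderiv_slice s f).
have dcurve : derivable (fun r => (Z r, r)) t 1.
  apply/derivable1_diffP/differentiable_pair => //.
  by apply/derivable1_diffP; exact: dZ.
apply: derivableM; first exact: dW.
have dpd : differentiable (pderiv (@dir_z R m) s f) (Z t, t).
  apply: (smooth_on_differentiable (smooth_on_pderiv (@dir_z R m) s sf)).
  by split => /=; [exact: OZ|rewrite in_itv].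
by have [] := is_derive_curve dcurve dpd.
Qed.

Lemma derivable_pairing (t : R) f : smooth_on (O `*` `]0, T[) f -> 0 < t < T ->
  derivable (fun r => pairing N Z W r f) t 1.
Proof.
move=> sf tT; rewrite /pairing /point_multipole.
apply: derivable_bigsum => a; apply: derivableZ; apply: derivable_bigsum => s.
by apply: derivable_pairing_term; rewrite // -ltnS ltn_ord.
Qed.

(** The time support confines every integral to a segment where all terms are derivable, so sums and
    integrals may be exchanged. The coefficients depend on time alone and pass through the spatial
    derivatives. *)
Lemma g_approxE f : smooth_on (O `*` `]0, T[) f -> time_supported al be f ->
  g_approx N T Z W f = \int[lebesgue_measure]_(t in `[al, be]) pairing N Z W t f.
Proof.
move=> sf f0.
have dterm (a : 'I_N.+1) (s : a.-tuple 'I_m) : {in `[al, be], forall t : R, derivable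
    (fun r => W a r s * pderiv (@basis_z R m) s (fun z => f (z, r)) (Z r)) t 1}.
  move=> t /segment_sub tT; apply: derivable_pairing_term => //.
  by rewrite -ltnS ltn_ord.
have dsum (a : 'I_N.+1) : {in `[al, be], forall t : R, derivable (fun r =>
    \sum_(s : a.-tuple 'I_m)
      W a r s * pderiv (@basis_z R m) s (fun z => f (z, r)) (Z r)) t 1}.
  by move=> t tab; apply: derivable_bigsum => s; exact: dterm.
rewrite /pairing /point_multipole Rintegral_bigsum; last first.
  by move=> a t tab; apply: derivableZ; exact: dsum.
rewrite /g_approx multipoleE; apply: eq_bigr => a _.
rewrite RintegralZl //; last exact: integrable_derivable.
congr (_ * _); rewrite Rintegral_bigsum //; apply: eq_bigr => s _.
rewrite -(@Rintegral_support _ al be T) //; last first.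
  move=> t tT tab; rewrite (_ : (fun z => f (z, t)) = cst 0) ?pderiv0 ?mulr0 //.
  by apply: funext => z; exact: f0.
apply: eq_Rintegral => t /set_mem /=; rewrite in_itv /= => tT.
rewrite -(pderiv_slice s (fun x => W a x.2 s * f x)) /=.
apply: (pderivMl _ oO) (OZ tT).
by apply: smooth_on_slice sf => //=; rewrite in_itv.
Qed.

End weak_form.

Lemma open_phase_space (R : realType) (d : nat) (Ou Ox : set 'rV[R]_d) :
  open Ou -> open Ox -> open (phase_space Ou Ox).
Proof.
move=> oOu oOx.
have -> : phase_space Ou Ox = lsubmx @^-1` Ou `&` rsubmx @^-1` Ox by [].
by apply: openI; apply: open_comp => // z _;
  [exact: continuous_lsubmx|exact: continuous_rsubmx].
Qed.

Theorem theorem3p1 (R : realType) (d N : nat) (hd : (0 < d)%N)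
    (Ou Ox : set 'rV[R]_d) (hOu : open Ou) (hOx : open Ox)
    (T : R) (hT : 0 < T)
    (Z : R -> 'rV[R]_(d + d)) (hZ : C1_on `[0, T] Z)
    (hZO : forall t, 0 <= t <= T -> phase_space Ou Ox (Z t))
    (W : forall a : nat, R -> tensor R (d + d) a)
    (hW : forall (a : nat) (s : a.-tuple 'I_(d + d)), (a <= N)%N ->
       C1_on `]0, T[ (fun t => W a t s))
    (hWsym : forall (a : nat) (t : R), (a <= N)%N -> 0 < t < T ->
       symmetric_tensor (W a t))
    (A : 'rV[R]_(d + d) * R -> 'rV[R]_(d + d))
    (hA : smooth_on (phase_space Ou Ox `*` `]0, T[) A)
    (Y : zmodType)
    (coupling : ('rV[R]_(d + d) * R -> 'rV[R]_(d + d)) ->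
       functional ('rV[R]_(d + d) * R)%type -> Y)
    (hcoupling : coupling A (g_approx N T Z W) = 0)
    (hmoments : moment_hierarchy N T A Z W)
    (hcenter : forall t, 0 < t < T -> derive1 Z t = A (Z t, t)) :
  distributional_solution (phase_space Ou Ox `*` `]0, T[) A
    (g_approx N T Z W).
Proof.
set O := phase_space Ou Ox in hA hZO *.
have oO : open O by exact: open_phase_space.
have oQ : open (O `*` `]0, T[) by apply: open_setX => //; exact: interval_open.
have OZ (t : R) : 0 < t < T -> O (Z t).
  by move=> /andP[t0 tT]; apply: hZO; rewrite !ltW.
have nbhs_oo (t : R) : 0 < t < T -> nbhs t [set` `]0, T[].
  by move=> tT; apply: open_nbhs_nbhs; split; [exact: interval_open|rewrite /= in_itv].
have dZ (t : R) : 0 < t < T -> derivable Z t 1.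
  move=> /nbhs_oo tT; apply: C1_on_derivable hZ.
  by apply: filterS tT; exact: subset_itv_oo_cc.
have dW a (s : a.-tuple 'I_(d + d)) (t : R) : (a <= N)%N -> 0 < t < T ->
    derivable (fun r => W a r s) t 1.
  by move=> aN /nbhs_oo tT; exact: C1_on_derivable tT (hW a s aN).
move=> phi tphi; have [sphi _ _] := tphi.
have [al [be [al0 albe beT phi0]]] := test_function_time_support hT tphi.
have sphiQ : smooth_on (O `*` `]0, T[) phi by exact: smooth_on_sub sphi.
have phi_supp : time_supported al be phi.
  move=> z t tab; apply: phi0 => /andP[alt tbe].
  by apply: tab; rewrite !ltW.
(* Testing the divergence against [phi] pairs [g_N] with these functions, which are smooth on the
   domain because [A] is. *)
pose f i := fun x : 'rV[R]_(d + d) * R => A x 0 i * 'D_(dir_z R i) phi x.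
have sf i : smooth_on (O `*` `]0, T[) (f i).
  by apply: smooth_onM => //; [exact: smooth_on_entry|exact: smooth_on_derive].
have f_supp i : time_supported al be (f i).
  by move=> z t tab; rewrite /f (derive_time_supported _ phi_supp) ?mulr0.
have sDt : smooth_on (O `*` `]0, T[) ('D_(dir_t R (d + d)) phi).
  exact: smooth_on_derive.
have Dt_supp := derive_time_supported (dir_t R (d + d)) phi_supp.
have dpair (h : 'rV[R]_(d + d) * R -> R) : smooth_on (O `*` `]0, T[) h ->
    {in `[al, be], forall t : R, derivable (fun r => pairing N Z W r h) t 1}.
  by move=> sh t tab; exact: (derivable_pairing OZ dZ dW sh (segment_sub al0 beT tab)).
have pairing0 (t : R) : 0 < t < T -> ~ al < t < be -> pairing N Z W t phi = 0.
  (* The zero slice is written [0 * 0] so that homogeneity of [point_multipole] gives the value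
     0. *)
  move=> tT tab; rewrite /pairing (_ : (fun z => phi (z, t)) = (fun=> 0 * 0)).
    by rewrite (point_multipoleMl _ _ oO (OZ t tT)) ?mul0r //; exact: smooth_on_cst.
  by apply: funext => z; rewrite phi0 // mulr0.
rewrite /fderive /fdiv /fderive /fmul (g_approxE oO OZ dZ dW al0 beT sDt Dt_supp).
(* Both terms carry the minus sign of [fderive]; without it there remains the integral of the
   pairings with the time derivative of [phi] and with the [f i]. *)
rewrite sumrN -opprD; apply/eqP; rewrite oppr_eq0; apply/eqP.
rewrite (eq_bigr (fun i =>
  \int[lebesgue_measure]_(t in `[al, be]) pairing N Z W t (f i))); last first.
  by move=> i _; exact: (g_approxE oO OZ dZ dW al0 beT (sf i) (f_supp i)).
rewrite -Rintegral_bigsum; last by move=> i; exact: dpair.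
have dsum : {in `[al, be], forall t : R,
    derivable (fun r => \sum_i pairing N Z W r (f i)) t 1}.
  by move=> t tab; apply: derivable_bigsum => i; exact: dpair.
rewrite -(RintegralD _ (integrable_derivable (dpair _ sDt))
  (integrable_derivable dsum)); last exact: measurable_itv.
(* The integrand is the derivative of the pairing with [phi], which vanishes at both end points by
   [pairing0]. *)
rewrite (@Rintegral_derive _ _ _ _ (fun r => pairing N Z W r phi) albe).
- rewrite !pairing0 ?subrr ?ltxx ?andbF //.
  + by rewrite al0 (lt_trans albe).
  + by rewrite beT (lt_trans al0).
- by move=> t tab; apply: derivableD; [exact: dpair|exact: dsum].
- move=> t /(segment_sub al0 beT) tT.
  exact: (is_derive_pairing oO OZ dZ dW hA hmoments hcenter sphi tT).
Qed.
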